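(* Let $\rho\in H_{n,+,1}$ be a state that is not in $\mathcal{P}$, and let $\tau^\star\in\mathcal{T}$. Then $R(\rho)=S(\rho\|\tau^\star)$ if and only if $\|\tau^{\star\Gamma}\|_1=1$ and, for all $\tau\in\mathcal{T}$, $$\mathrm{Tr}[L_{\tau^\star}(\rho)\,\tau]\le\mathrm{Tr}[L_{\tau^\star}(\rho)\,\tau^\star]=1.$$
   Context: Let $n=n_1n_2$ and $\mathbb{C}^n=\mathbb{C}^{n_1}\otimes\mathbb{C}^{n_2}$. $H_n$ denotes the $n\times n$ hermitian matrices, $H_{n,+}$ the positive semidefinite ones, and $H_{n,+,1}$ the positive semidefinite ones of unit trace (states). $A^\Gamma$ denotes the partial transpose of $A$ with respect to a fixed one of the two tensor factors. $\mathcal{P}=\{\sigma\in H_{n,+,1}:\sigma^\Gamma\ge0\}$ is the set of PPT states. $\|A\|_1=\mathrm{Tr}|A|$ is the trace norm and $\mathcal{T}=\{\tau\in H_{n,+}:\|\tau^\Gamma\|_1\le1\}$. The relative entropy of $\rho\in H_{n,+,1}$ and $\sigma\in H_{n,+}$ is $S(\rho\|\sigma)=\mathrm{Tr}[\rho(\log\rho-\log\sigma)]$ (natural logarithm, with $0\log0=0$ and $\log\sigma$ taken on the support of $\sigma$) if $\rho$ is zero outside the support of $\sigma$ (i.e. $\ker\sigma\subseteq\ker\rho$), and $S(\rho\|\sigma)=+\infty$ otherwise. The Rains bound is $R(\rho)=\min_{\tau\in\mathcal{T}}S(\rho\|\tau)$. For $A\in H_{n,+}$ with eigenvalues $a_1,\dots,a_n$,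 the linear map $L_A$ on $n\times n$ matrices is defined, in an orthonormal eigenbasis of $A$, by $L_A(B)=T_A\circ B$ (entrywise product), where $[T_A]_{ij}=\frac{\log a_i-\log a_j}{a_i-a_j}$ if $a_i\ne a_j$ and $a_i,a_j>0$; $[T_A]_{ij}=1/a_i$ if $a_i=a_j>0$; and $[T_A]_{ij}=0$ if $a_i=0$ or $a_j=0$. *)

(* Defs.v *)
(* MathComp / MathComp-Analysis; complex numbers are R[i] over R : realType. *)
From HB Require Import structures.
From mathcomp Require Import all_boot all_order all_algebra.
From mathcomp Require Import spectral.
From mathcomp Require Import complex mxtens.
From mathcomp Require Import boolp classical_sets constructive_ereal reals ereal.
From mathcomp Require Import exp.

Set Implicit Arguments.
Unset Strict Implicit.
Unset Printing Implicit Defensive.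

Import Order.TTheory GRing.Theory Num.Theory.
Local Open Scope ring_scope.
Local Open Scope complex_scope.
Local Open Scope sesquilinear_scope.
Local Open Scope classical_set_scope.

(* The order on R[i] is partial: x <= y means that y - x is real and
   nonnegative, so 0 <= x and x <= 1 both imply that x is real. *)
Definition psdmx (R : realType) (n : nat) : set 'M[R[i]]_n :=
  [set A | A \is hermsymmx /\ forall v : 'cV[R[i]]_n, 0 <= \tr (v^t* *m A *m v)].

Definition state (R : realType) (n : nat) : set 'M[R[i]]_n :=
  [set A | psdmx A /\ \tr A = 1].

(* The basis vector e_i (x) e_j of C^n1 (x) C^n2 has index mxtens_index (i, j).
   The transpose acts on the first factor if [first] holds, and on the second
   factor otherwise. *)
Definition ptrmx (R : realType) (n1 n2 : nat) (first : bool)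
    (A : 'M[R[i]]_(n1 * n2)) : 'M[R[i]]_(n1 * n2) :=
  \matrix_(k, l)
    let: (k1, k2) := mxtens_unindex k in
    let: (l1, l2) := mxtens_unindex l in
    if first then A (mxtens_index (l1, k2)) (mxtens_index (k1, l2))
             else A (mxtens_index (k1, l2)) (mxtens_index (l1, k2)).

Definition ppt (R : realType) (n1 n2 : nat) (first : bool) :
    set 'M[R[i]]_(n1 * n2) :=
  [set A | state A /\ psdmx (ptrmx first A)].

(* Real part of the eigenvalue of index i; it is the eigenvalue itself when A is
   hermitian.  One has A = U^t* *m diag_mx (spectral_diag A) *m U with
   U = spectralmx A unitary when A is normal, so the i-th column of U^t* is a
   unit eigenvector for this eigenvalue. *)
Definition eigval (R : realType) (n : nat) (A : 'M[R[i]]_n) (i : 'I_n) : R :=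
  complex.Re (spectral_diag A 0 i).

(* Functional calculus, meaningful for hermitian A. *)
Definition hermfun (R : realType) (n : nat) (f : R -> R) (A : 'M[R[i]]_n) :
    'M[R[i]]_n :=
  (spectralmx A)^t* *m diag_mx (\row_i (f (eigval A i))%:C) *m spectralmx A.

(* As ln 0 = 0 in the library, the logarithm of a positive semidefinite matrix
   is taken on its support and vanishes on its kernel. *)
Definition logmx (R : realType) (n : nat) (A : 'M[R[i]]_n) : 'M[R[i]]_n :=
  hermfun (@ln R) A.

Definition absmx (R : realType) (n : nat) (A : 'M[R[i]]_n) : 'M[R[i]]_n :=
  hermfun (@Num.sqrt R) (A^t* *m A).

Definition trnorm (R : realType) (n : nat) (A : 'M[R[i]]_n) : R[i] :=
  \tr (absmx A).

Definition rains_set (R : realType) (n1 n2 : nat) (first : bool) :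
    set 'M[R[i]]_(n1 * n2) :=
  [set tau | psdmx tau /\ trnorm (ptrmx first tau) <= 1].

Definition relent (R : realType) (n : nat) (rho sigma : 'M[R[i]]_n) : \bar R :=
  if `[< forall v : 'cV[R[i]]_n, sigma *m v = 0 -> rho *m v = 0 >]
  then (complex.Re (\tr (rho *m (logmx rho - logmx sigma))))%:E
  else +oo%E.

(* The infimum is a minimum: rains_set is compact and relent rho is lower
   semicontinuous on it. *)
Definition rains (R : realType) (n1 n2 : nat) (first : bool)
    (rho : 'M[R[i]]_(n1 * n2)) : \bar R :=
  ereal_inf [set relent rho tau | tau in @rains_set R n1 n2 first].

Definition log_divdiff (R : realType) (a b : R) : R :=
  if (0 < a) && (0 < b) then
    if a == b then a^-1 else (ln a - ln b) / (a - b)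
  else 0.

(* B is expressed in the orthonormal eigenbasis of A, as
   spectralmx A *m B *m (spectralmx A)^t*, multiplied entrywise by the divided
   differences, and transported back; the result does not depend on the
   eigenbasis. *)
Definition Lmx (R : realType) (n : nat) (A B : 'M[R[i]]_n) : 'M[R[i]]_n :=
  let U := spectralmx A in
  let B' := U *m B *m U^t* in
  U^t* *m (\matrix_(i, j) ((log_divdiff (eigval A i) (eigval A j))%:C * B' i j))
    *m U.

(* Main.v *)
(* Tr rho log(B + s) has s-derivative Tr rho (B + s)^-1, so, with
   X = (A + s)^-1, Y = (B + s)^-1 and D = B - A, the remainder
     F(s) = Tr rho log(B + s) - Tr rho log(A + s) - Tr L_(A+s)(rho) D
   satisfies F'(s) = Tr rho X D Y D X >= 0 and F(s) = O(1/s) at infinity.  Hence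
   F(0) <= 0, which is the gradient inequality of the operator concave
   logarithm; it needs only that rho lives on the supports of A and B, and it
   gives the sufficiency of the condition on L_taustar(rho).  Since
   Tr L_A(rho) A is the mass of rho on the support of A, the value 1 encodes
   ker taustar <= ker rho.

   Conversely, let A = taustar minimise and B = A + t (tau - A).  The derivative
   at the boundary point A is reached through the shift s: from
   B + s >= (1 - t) (A + s) one gets
     Tr rho log(B + s) - Tr rho log(A + s)
       <= Tr rho log B - Tr rho log A + O(t s),
   and |F(s)| = O(t^2 / s^2), so that t = s^3 and s -> 0 give
   Tr L_A(rho) (tau - A) <= 0.  Applied to tau = c taustar with c > 1, this
   excludes that the partial transpose of taustar has trace norm below 1. *)

Require Import Defs.
From mathcomp Require Import all_boot all_order all_algebra.
From mathcomp Require Import spectral complex mxtens.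
From mathcomp Require Import boolp classical_sets functions constructive_ereal reals ereal.
From mathcomp Require Import topology normedtype derive realfun exp.
From mathcomp Require Import ring lra.

Set Implicit Arguments.
Unset Strict Implicit.
Unset Printing Implicit Defensive.

Import Order.TTheory GRing.Theory Num.Theory.
Import numFieldNormedType.Exports.
Local Open Scope ring_scope.
Local Open Scope complex_scope.
Local Open Scope sesquilinear_scope.

(** * Real parts of complex scalars *)

Section ComplexParts.
Variable R : realType.
Implicit Types (x : R) (z w : R[i]).
Local Notation Re := (@complex.Re R).

Lemma ReD z w : Re (z + w) = Re z + Re w. Proof. by case: z; case: w. Qed.
Lemma ReN z : Re (- z) = - Re z. Proof. by case: z. Qed.
Lemma ReB z w : Re (z - w) = Re z - Re w. Proof. by rewrite ReD ReN. Qed.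
Lemma ReZ x z : Re (x%:C * z) = x * Re z.
Proof. by case: z => a b /=; rewrite mul0r subr0. Qed.
Lemma Re_sum (I : finType) (f : I -> R[i]) : Re (\sum_i f i) = \sum_i Re (f i).
Proof. exact: (big_morph Re ReD). Qed.
Lemma conjCR x : Num.conj (x%:C) = x%:C.
Proof. by apply/CrealP; apply/complex_realP; exists x. Qed.
Lemma Re_ge0 z : 0 <= z -> 0 <= Re z.
Proof. by rewrite lecE => /andP[]. Qed.
End ComplexParts.

(** * Positive semidefinite matrices and unitary diagonalisation *)

Section Matrices.
Variables (R : realType) (n : nat).
Local Notation C := R[i].
Local Notation Re := (@complex.Re R).
Implicit Types (A B D M N rho : 'M[C]_n) (d e : 'I_n -> R) (s : R).

Lemma ctrM m p q (A : 'M[C]_(m, p)) (B : 'M[C]_(p, q)) :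
  (A *m B)^t* = B^t* *m A^t*.
Proof. by rewrite trmx_mul map_mxM. Qed.
Lemma ctrD m p (A B : 'M[C]_(m, p)) : (A + B)^t* = A^t* + B^t*.
Proof. by rewrite linearD map_mxD. Qed.
Lemma ctrB m p (A B : 'M[C]_(m, p)) : (A - B)^t* = A^t* - B^t*.
Proof. by rewrite linearB map_mxB. Qed.
Lemma ctrZ m p x (A : 'M[C]_(m, p)) : (x%:C *: A)^t* = x%:C *: A^t*.
Proof. apply/matrixP => i j; rewrite !mxE rmorphM; congr (_ * _); exact: conjCR. Qed.
Lemma trace_ctr A : \tr (A^t*) = Num.conj (\tr A).
Proof. by rewrite /mxtrace rmorph_sum; apply: eq_bigr => i _; rewrite !mxE. Qed.

Lemma hermP A : reflect (A^t* = A) (A \is hermsymmx).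
Proof.
by apply: (iffP (is_hermitianmxP _ _ _)); rewrite expr0 scale1r => /esym //.
Qed.

(** Taking the real part moves all estimates into the ordered field [R]; for a product of two
    hermitian matrices the trace is real, so nothing is lost. *)
Definition rtr A : R := Re (\tr A).

Lemma rtrD A B : rtr (A + B) = rtr A + rtr B.
Proof. by rewrite /rtr linearD ReD. Qed.
Lemma rtrB A B : rtr (A - B) = rtr A - rtr B.
Proof. by rewrite /rtr linearB ReB. Qed.
Lemma rtrZ x A : rtr (x%:C *: A) = x * rtr A.
Proof. by rewrite /rtr linearZ ReZ. Qed.
Lemma rtrC A B : rtr (A *m B) = rtr (B *m A).
Proof. by rewrite /rtr mxtrace_mulC. Qed.

Lemma psd_herm A : psdmx A -> A^t* = A.
Proof. by case=> /hermP. Qed.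

Lemma psd_entryC A i j : psdmx A -> A i j = Num.conj (A j i).
Proof. by move/psd_herm => {1}<-; rewrite !mxE. Qed.

Lemma psdD A B : psdmx A -> psdmx B -> psdmx (A + B).
Proof.
move=> [/hermP hA pA] [/hermP hB pB]; split; first by apply/hermP; rewrite ctrD hA hB.
by move=> v; rewrite mulmxDr mulmxDl linearD addr_ge0 ?pA ?pB.
Qed.

Lemma psdZ x A : 0 <= x -> psdmx A -> psdmx (x%:C *: A).
Proof.
move=> x0 [/hermP hA pA]; split; first by apply/hermP; rewrite ctrZ hA.
by move=> v; rewrite -scalemxAr -scalemxAl linearZ mulr_ge0 ?pA // ler0c.
Qed.

Lemma psd_conj N A : psdmx A -> psdmx (N *m A *m N^t*).
Proof.
move=> [/hermP hA pA]; split.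
  by apply/hermP; rewrite !ctrM trmxCK hA mulmxA.
by move=> v; have := pA (N^t* *m v); rewrite ctrM trmxCK !mulmxA.
Qed.

Lemma psd_quad A (v : 'cV[C]_n) : psdmx A -> 0 <= (v^t* *m A *m v) 0 0.
Proof. by move=> [_ /(_ v)]; rewrite /mxtrace big_ord1. Qed.

Lemma psd_diag_ge0 A i : psdmx A -> 0 <= A i i.
Proof.
move=> /(psd_quad (delta_mx i 0)).
rewrite trmx_delta map_delta_mx -rowE -colE.
by rewrite mxE mxE.
Qed.

Definition dg (U : 'M[C]_n) d : 'M[C]_n :=
  U^t* *m diag_mx (\row_i (d i)%:C) *m U.

Definition inbase (U M : 'M[C]_n) := U *m M *m U^t*.

Section Unitary.
Variable U : 'M[C]_n.
Hypothesis Uu : U \is unitarymx.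

Lemma UK : U *m U^t* = 1%:M. Proof. exact/unitarymxP. Qed.
Lemma KU : U^t* *m U = 1%:M. Proof. exact/mulmx1C/UK. Qed.

Lemma inbase_dg d : inbase U (dg U d) = diag_mx (\row_i (d i)%:C).
Proof. by rewrite /inbase /dg !mulmxA UK mul1mx -mulmxA UK mulmx1. Qed.

Lemma dgM d e : dg U d *m dg U e = dg U (fun i => d i * e i).
Proof.
rewrite /dg; have -> : \row_i (d i * e i)%:C =
    \row_j ((\row_i (d i)%:C) 0 j * (\row_i (e i)%:C) 0 j).
  by apply/rowP => i; rewrite !mxE rmorphM.
by rewrite -mulmx_diag !mulmxA (mulmxtVK _ Uu).
Qed.

Lemma dgD d e : dg U d + dg U e = dg U (fun i => d i + e i).
Proof.
rewrite /dg; have -> : \row_i (d i + e i)%:C = \row_i (d i)%:C + \row_i (e i)%:C.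
  by apply/rowP => i; rewrite !mxE rmorphD.
by rewrite linearD /= mulmxDr mulmxDl.
Qed.

Lemma dg_cst x : dg U (fun=> x) = x%:C%:M.
Proof.
rewrite /dg; have -> : diag_mx (\row__ x%:C) = x%:C%:M :> 'M[C]_n.
  by apply/matrixP => i j; rewrite !mxE.
by rewrite scalar_mxC -mulmxA KU mulmx1.
Qed.

Lemma dg_herm d : (dg U d)^t* = dg U d.
Proof.
rewrite /dg !ctrM trmxCK mulmxA.
have -> : (diag_mx (\row_i (d i)%:C))^t* = diag_mx (\row_i (d i)%:C).
  apply/matrixP => i j; rewrite !mxE eq_sym; case: eqP => [->|_].
    by rewrite !mulr1n conjCR.
  by rewrite !mulr0n rmorph0.
by [].
Qed.

Lemma dgZ x d : x%:C *: dg U d = dg U (fun i => x * d i).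
Proof.
rewrite /dg; have -> : \row_i (x * d i)%:C = x%:C *: \row_i (d i)%:C.
  by apply/rowP => i; rewrite !mxE rmorphM.
by rewrite linearZ /= -scalemxAr -scalemxAl.
Qed.

Lemma rtr_dg rho d : rtr (rho *m dg U d) = \sum_i d i * Re (inbase U rho i i).
Proof.
rewrite /dg mulmxA mulmxA rtrC !mulmxA -/(inbase U rho) /rtr mul_mx_diag /mxtrace.
rewrite Re_sum; apply: eq_bigr => i _.
by rewrite !mxE mulrC ReZ.
Qed.

Lemma rtr_inbase M : rtr (inbase U M) = rtr M.
Proof. by rewrite /inbase rtrC mulmxA KU mul1mx. Qed.

Lemma rtr_dgE d : rtr (dg U d) = \sum_i d i.
Proof.
rewrite -rtr_inbase inbase_dg /rtr mxtrace_diag Re_sum.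
by apply: eq_bigr => i _; rewrite mxE.
Qed.

Lemma inbaseM M N : inbase U (M *m N) = inbase U M *m inbase U N.
Proof. by rewrite /inbase !mulmxA -[_ *m U^t* *m U]mulmxA KU mulmx1. Qed.

Lemma inbaseK M : U^t* *m inbase U M *m U = M.
Proof. by rewrite /inbase !mulmxA KU mul1mx -mulmxA KU mulmx1. Qed.

Lemma dg_psd d : (forall i, 0 <= d i) -> psdmx (dg U d).
Proof.
move=> d0; rewrite /dg -[U in _ *m U]trmxCK; apply: psd_conj; split.
  apply/hermP/matrixP => i j; rewrite !mxE eq_sym; case: eqP => [->|_].
    by rewrite !mulr1n conjCR.
  by rewrite !mulr0n rmorph0.
move=> v; rewrite mul_mx_diag /mxtrace big_ord1 mxE sumr_ge0 // => i _.
rewrite !mxE mulrAC [_^* * _]mulrC -normCK mulr_ge0 ?exprn_ge0 //.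
by rewrite ler0c.
Qed.

(* V U^* intertwines the two diagonals, hence only links indices carrying the
   same value. *)
Lemma dg_fun (V : 'M[C]_n) (f : R -> R) d e : V \is unitarymx ->
  dg U d = dg V e -> dg U (fun i => f (d i)) = dg V (fun i => f (e i)).
Proof.
move=> Vu E; set W := V *m U^t*.
have VK : V *m V^t* = 1%:M by exact/unitarymxP.
have KV : V^t* *m V = 1%:M by exact/mulmx1C.
have EW : W *m diag_mx (\row_i (d i)%:C) = diag_mx (\row_i (e i)%:C) *m W.
  have : V *m (dg U d) *m U^t* = V *m (dg V e) *m U^t* by rewrite E.
  by rewrite /dg !mulmxA VK mul1mx -!mulmxA UK mulmx1 !mulmxA.
have {}EW : W *m diag_mx (\row_i (f (d i))%:C) = diag_mx (\row_i (f (e i))%:C) *m W.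
  move: W EW => W /matrixP EW; apply/matrixP => i j; move: (EW i j).
  rewrite !mul_mx_diag !mul_diag_mx !mxE [_ * W _ _]mulrC [(f _)%:C * _]mulrC.
  have [-> _|W0] := eqVneq (W i j) 0; first by rewrite !mul0r.
  by move/(mulfI W0)/complexI ->.
transitivity (V^t* *m W *m diag_mx (\row_i (f (d i))%:C) *m U).
  by rewrite /W mulmxA KV mul1mx.
by rewrite -[V^t* *m W *m _]mulmxA EW /W /dg !mulmxA (mulmxKtV _ Uu erefl).
Qed.

End Unitary.

Local Notation eU := spectralmx.

Lemma spectral_dg A : A^t* = A -> A = dg (eU A) (eigval A).
Proof.
move=> hA; have hA' : A \is hermsymmx by apply/hermP.
have /orthomx_spectralP {1}-> := hermitian_normalmx hA'.
rewrite (invmx_unitary (spectral_unitarymx A)) /dg.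
have {1}-> : spectral_diag A = \row_i (eigval A i)%:C.
  apply/rowP => i; rewrite !mxE /eigval RRe_real //.
  exact: (mxOverP (hermitian_spectral_diag_real hA')).
by [].
Qed.

(** Frees the functional calculus from the eigenbasis chosen by [spectralmx]: any unitary
    diagonalisation of [A] gives the same matrix. *)
Lemma hermfun_dg (f : R -> R) A U d : U \is unitarymx ->
  A = dg U d -> hermfun f A = dg U (fun i => f (d i)).
Proof.
move=> Uu E; have hA : A^t* = A by rewrite E dg_herm.
rewrite /hermfun -/(dg _ (fun i => f (eigval A i))).
by apply: dg_fun; rewrite ?spectral_unitarymx // -spectral_dg.
Qed.

Lemma psd_inbase U A : psdmx A -> psdmx (inbase U A).
Proof. exact: psd_conj. Qed.

Lemma eigval_diag A i : A^t* = A -> inbase (eU A) A i i = (eigval A i)%:C.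
Proof.
move=> hA; rewrite {2}(spectral_dg hA) inbase_dg ?spectral_unitarymx //.
by rewrite !mxE eqxx mulr1n.
Qed.

Lemma eigval_ge0 A i : psdmx A -> 0 <= eigval A i.
Proof.
move=> pA; have := psd_diag_ge0 i (psd_inbase (eU A) pA).
by rewrite eigval_diag ?ler0c //; exact: psd_herm.
Qed.

Lemma rtr_psd_ge0 A B : psdmx A -> psdmx B -> 0 <= rtr (A *m B).
Proof.
move=> pA pB; rewrite (spectral_dg (psd_herm pB)) rtr_dg ?spectral_unitarymx //.
apply: sumr_ge0 => i _; rewrite mulr_ge0 ?eigval_ge0 //.
exact/Re_ge0/psd_diag_ge0/psd_inbase.
Qed.

(** In the eigenbasis the quadratic form is a sum of nonnegative terms, eigenvalue times squared
    modulus of a coordinate, so each term vanishes separately. *)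
Lemma psd_quad0 A (v : 'cV[C]_n) :
  psdmx A -> (v^t* *m A *m v) 0 0 = 0 -> A *m v = 0.
Proof.
move=> pA; rewrite {1 2}(spectral_dg (psd_herm pA)) /dg.
set U := eU A; set w := U *m v => q0.
have q : \sum_i (eigval A i)%:C * `|w i 0| ^+ 2 = 0.
  apply: (etrans _ q0); rewrite !mulmxA -ctrM -/w -mulmxA -/w mul_mx_diag mxE.
  by apply: eq_bigr => i _; rewrite !mxE mulrAC [_^* * _]mulrC -normCK mulrC.
rewrite -!mulmxA -/w; suff -> : diag_mx (\row_i (eigval A i)%:C) *m w = 0.
  by rewrite mulmx0.
apply/matrixP => i j; rewrite (ord1 j) mul_diag_mx mxE [X in X * _]mxE [RHS]mxE.
have ge0 k : true -> 0 <= (eigval A k)%:C * `|w k 0| ^+ 2.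
  by move=> _; rewrite mulr_ge0 ?exprn_ge0 // ler0c eigval_ge0.
move/eqP: (psumr_eq0P ge0 q (i := i) isT).
by rewrite mulf_eq0 expf_eq0 normr_eq0 /= => /orP[]/eqP->; rewrite ?mul0r ?mulr0.
Qed.

(** [psd_quad0] at the i-th basis vector kills the i-th column, and hermitian symmetry carries this
    over to the row. *)
Lemma psd_diag0 A i j : psdmx A -> A i i = 0 -> A i j = 0.
Proof.
move=> pA A0; have : A *m delta_mx i 0 = 0 :> 'cV__.
  apply: psd_quad0 => //; rewrite trmx_delta map_delta_mx -rowE -colE.
  by rewrite !mxE.
rewrite -colE => /matrixP/(_ j 0); rewrite !mxE => Aji.
by rewrite -(psd_herm pA) !mxE Aji rmorph0.
Qed.

End Matrices.

(** * Resolvents, their operator monotonicity, and supports *)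

Section Resolvent.
Variables (R : realType) (n : nat).
Local Notation C := R[i].
Local Notation Re := (@complex.Re R).
Local Notation eU := spectralmx.
Implicit Types (A B D M N X Y rho : 'M[C]_n) (d e : 'I_n -> R) (s t : R).

(** The exact second-order Taylor remainder of the matrix inverse at X, obtained by using the
    resolvent identity twice. *)
Lemma inv_expansion X Y X' Y' :
    X *m X' = 1%:M -> Y *m Y' = 1%:M ->
  Y' - X' + X' *m (Y - X) *m X' = X' *m (Y - X) *m Y' *m (Y - X) *m X'.
Proof.
move=> XK YK; have KX := mulmx1C XK; have KY := mulmx1C YK.
rewrite -[RHS]mulmxA mulmxBr KX [(Y - X) *m X']mulmxBl XK.
rewrite [(_ - _) *m X']mulmxBl mul1mx [(_ - _) *m Y']mulmxBl.
rewrite -[X' *m Y *m Y']mulmxA YK mulmx1 !mul1mx.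
by rewrite mulmxBr mulmx1 mulmxBl !mulmxA KY mul1mx opprB addrC.
Qed.

(** With Z = Y' - X'/c, the difference X'/c - Y' equals Z (c X) Z + Y' (Y - c X) Y', a sum of two
    conjugates of positive matrices; no square roots enter. *)
Lemma inv_antitone c X Y X' Y' : 0 < c ->
    X *m X' = 1%:M -> Y *m Y' = 1%:M -> X'^t* = X' -> Y'^t* = Y' ->
    psdmx X -> psdmx (Y - c%:C *: X) ->
  psdmx ((c^-1)%:C *: X' - Y').
Proof.
move=> c0 XK YK hX hY pX pYX; have KX := mulmx1C XK; have KY := mulmx1C YK.
have cc : c%:C * (c^-1)%:C = 1 by rewrite -rmorphM mulfV ?gt_eqF.
set Z := Y' - (c^-1)%:C *: X'.
have hZ : Z^t* = Z by rewrite /Z ctrB ctrZ hX hY.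
have -> : (c^-1)%:C *: X' - Y' = Z *m (c%:C *: X) *m Z^t* +
    Y' *m (Y - c%:C *: X) *m Y'^t*.
  have -> : Z *m (c%:C *: X) *m Z^t* = c%:C *: (Y' *m X *m Y') - Y' - Z.
    have -> : Z *m (c%:C *: X) = c%:C *: (Y' *m X) - 1%:M.
      by rewrite mulmxBl -scalemxAl -!scalemxAr scalerA mulrC cc scale1r KX.
    rewrite hZ mulmxBl mul1mx {1}/Z mulmxBr -!scalemxAl -scalemxAr -!mulmxA XK.
    by rewrite mulmx1 scalerA cc scale1r.
  have -> : Y' *m (Y - c%:C *: X) *m Y'^t* = Y' - c%:C *: (Y' *m X *m Y').
    by rewrite hY mulmxBr KY mulmxBl mul1mx -scalemxAr -scalemxAl.
  by rewrite [RHS]addrC -[_ - Y' - Z]addrA subrKA addrA subrr sub0r opprB.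
exact: (psdD (psd_conj _ (psdZ (ltW c0) pX)) (psd_conj _ pYX)).
Qed.

Definition res A s := dg (eU A) (fun i => (eigval A i + s)^-1).

Lemma shift_dg A s : psdmx A ->
  A + s%:C%:M = dg (eU A) (fun i => eigval A i + s).
Proof.
move=> pA; rewrite {1}(spectral_dg (psd_herm pA)).
by rewrite -(dg_cst (spectral_unitarymx A)) dgD.
Qed.

Lemma eig_shift_gt0 A s i : psdmx A -> 0 < s -> 0 < eigval A i + s.
Proof. by move=> pA s0; rewrite ltr_wpDl ?eigval_ge0. Qed.

Lemma resK A s : psdmx A -> 0 < s -> (A + s%:C%:M) *m res A s = 1%:M.
Proof.
move=> pA s0; rewrite shift_dg // dgM ?spectral_unitarymx //.
rewrite -[RHS](dg_cst (spectral_unitarymx A) 1); congr dg.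
by apply/funext => i; rewrite mulfV // gt_eqF // eig_shift_gt0.
Qed.

Lemma res_herm A s : (res A s)^t* = res A s.
Proof. by rewrite dg_herm. Qed.

Lemma res_psd A s : psdmx A -> 0 < s -> psdmx (res A s).
Proof.
by move=> pA s0; apply: dg_psd => i; rewrite invr_ge0 ltW ?eig_shift_gt0.
Qed.

Lemma shift_psd A s : psdmx A -> 0 <= s -> psdmx (A + s%:C%:M).
Proof.
move=> pA s0; rewrite (shift_dg s pA); apply: dg_psd => i.
by rewrite addr_ge0 // eigval_ge0.
Qed.

Lemma res_expansion A B s : psdmx A -> psdmx B -> 0 < s ->
  res B s - res A s + res A s *m (B - A) *m res A s =
  res A s *m (B - A) *m res B s *m (B - A) *m res A s.
Proof.
move=> pA pB s0; have := inv_expansion (resK pA s0) (resK pB s0).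
by have -> : B + s%:C%:M - (A + s%:C%:M) = B - A by rewrite opprD addrACA subrr addr0.
Qed.

Lemma res_antitone A B c s : 0 < c -> c <= 1 -> 0 < s ->
    psdmx A -> psdmx B -> psdmx (B - c%:C *: A) ->
  psdmx ((c^-1)%:C *: res A s - res B s).
Proof.
move=> c0 c1 s0 pA pB pBA.
apply: (inv_antitone c0 (resK pA s0) (resK pB s0) (res_herm A s) (res_herm B s)).
  exact/shift_psd/ltW.
(* Since c <= 1, shifting both matrices by s only adds the nonnegative scalar (1 - c) s to the
   gap. *)
have -> : B + s%:C%:M - c%:C *: (A + s%:C%:M) =
    (B - c%:C *: A) + ((1 - c) * s)%:C%:M.
  rewrite scalerDr opprD addrACA; congr (_ + _).
  by rewrite scale_scalar_mx -raddfB mulrBl mul1r rmorphB rmorphM.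
by apply: shift_psd => //; rewrite mulr_ge0 ?subr_ge0 // ltW.
Qed.

(** The kernel inclusion of [relent], read in the eigenbasis of [A]. In this form it removes exactly
    the summands where ln or an inverse would be evaluated at 0. *)
Definition suppd rho A :=
  forall i j, eigval A i = 0 -> inbase (eU A) rho i j = 0.

Lemma suppdP rho A : psdmx rho -> psdmx A ->
  suppd rho A <-> (forall v : 'cV[C]_n, A *m v = 0 -> rho *m v = 0).
Proof.
move=> pr pA; set U := eU A.
have Uu : U \is unitarymx := spectral_unitarymx A.
have pr' := psd_inbase U pr.
split=> [S v Av|S i j ai].
  have Uv i : (eigval A i)%:C * (U *m v) i 0 = 0.
    have : U *m A *m v = 0 by rewrite -mulmxA Av mulmx0.
    rewrite {1}(spectral_dg (psd_herm pA)) /dg -/U !mulmxA UK // mul1mx -mulmxA.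
    by move/matrixP/(_ i 0); rewrite mul_diag_mx mxE [X in X * _]mxE [RHS]mxE.
  have -> : rho *m v = U^t* *m (inbase U rho *m (U *m v)).
    by rewrite -{1}(inbaseK Uu rho) !mulmxA.
  suff -> : inbase U rho *m (U *m v) = 0 by rewrite mulmx0.
  apply/matrixP => k j; rewrite (ord1 j) [RHS]mxE mxE big1 // => i _.
  move/eqP: (Uv i); rewrite mulf_eq0 => /orP[|/eqP->]; last by rewrite mulr0.
  rewrite fmorph_eq0 => /eqP ai; rewrite (psd_entryC k i pr').
  by rewrite [inbase U rho i k]S // rmorph0 mul0r.
(* The test vector is the i-th eigenvector of [A], which lies in the kernel. *)
have : A *m (U^t* *m delta_mx i 0 : 'cV__) = 0.
  rewrite {1}(spectral_dg (psd_herm pA)) /dg -/U -!mulmxA [U *m _]mulmxA UK // mul1mx.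
  rewrite (_ : diag_mx _ *m _ = 0) ?mulmx0 //.
  apply/matrixP => k l; rewrite mul_diag_mx !mxE (ord1 l) eqxx andbT.
  by case: eqP => [->|_]; rewrite ?ai ?mul0r ?mulr0.
move/S; rewrite mulmxA => /(congr1 (mulmx U)).
rewrite mulmx0 !mulmxA -/(inbase U rho) -colE => /matrixP/(_ j 0).
rewrite mxE [RHS]mxE => rji.
by rewrite (psd_entryC i j pr') [inbase U rho j i]rji rmorph0.
Qed.

(** On the kernel of the mixture both nonnegative quadratic forms (1 - t) A and t T vanish; as 1 - t
    is nonzero, this kernel lies in that of [A]. *)
Lemma suppd_mix rho A T t : psdmx rho -> psdmx A -> psdmx T -> 0 <= t -> t < 1 ->
  suppd rho A -> psdmx (A + t%:C *: (T - A)) -> suppd rho (A + t%:C *: (T - A)).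
Proof.
move=> pr pA pT t0 t1 S pM; apply/(suppdP pr pM) => v Mv.
apply: ((suppdP pr pA).1 S); apply: psd_quad0 => //.
have E : A + t%:C *: (T - A) = (1 - t)%:C *: A + t%:C *: T.
  by rewrite rmorphB scalerBl scale1r scalerBr addrCA addrC.
have : (1 - t)%:C * (v^t* *m A *m v) 0 0 + t%:C * (v^t* *m T *m v) 0 0 = 0.
  have : v^t* *m (A + t%:C *: (T - A)) *m v = 0 by rewrite -mulmxA Mv mulmx0.
  rewrite E mulmxDr mulmxDl -!scalemxAr -!scalemxAl => /matrixP/(_ 0 0).
  by rewrite mxE [X in X + _]mxE [X in _ + X]mxE [RHS]mxE.
have qA := psd_quad v pA; have qT := psd_quad v pT.
have t1' : 0 <= (1 - t)%:C by rewrite ler0c subr_ge0 ltW.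
have t0' : 0 <= t%:C by rewrite ler0c.
move/eqP; rewrite (paddr_eq0 (mulr_ge0 t1' qA) (mulr_ge0 t0' qT)).
case/andP; rewrite mulf_eq0 fmorph_eq0 subr_eq0 => /orP[/eqP t1E|/eqP ->//].
by move: t1; rewrite -t1E ltxx.
Qed.

End Resolvent.

(** * One-variable calculus: monotonicity, logarithms and their divided differences *)

Section RealCalculus.
Variable R : realType.
Implicit Types (f : R -> R) (s x y K : R).

Lemma is_derive_ge0_le f (f' : R -> R) x y : x <= y ->
    (forall s, x <= s -> is_derive s 1 f (f' s)) ->
    (forall s, x < s -> 0 <= f' s) ->
  f x <= f y.
Proof.
move=> xy df f'0; apply: (@ger0_derive1_ndecr _ f x y) => //.
- by move=> s; rewrite in_itv /= => /andP[/ltW/df[]].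
- move=> s; rewrite in_itv /= => /andP[xs _].
  by rewrite derive1E; have [_ ->] := df s (ltW xs); exact: f'0.
- apply: derivable_within_continuous => s; rewrite in_itv /= => /andP[xs _].
  by have [] := df s xs.
Qed.

(** Stands in for a limit at infinity: a bound x <= K / s for all large s forces x <= 0. *)
Lemma le0_bounded_mul x y K : (forall s, y < s -> x * s <= K) -> x <= 0.
Proof.
move=> xK; rewrite leNgt; apply/negP => x0.
(* The first two summands exceed y, and the last one alone already pushes x * s beyond K. *)
have s0 : y < `|y| + 1 + (`|K| + 1) / x.
  have := ler_norm y; have : 0 <= (`|K| + 1) / x by rewrite divr_ge0 ?addr_ge0 // ltW.
  by lra.
have := xK _ s0; rewrite mulrDr mulrCA divff ?gt_eqF // mulr1 => h.
have := ler_norm K; have : 0 <= x * (`|y| + 1) by rewrite mulr_ge0 ?addr_ge0 // ltW.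
by move=> h1 h2; move: h h1 h2; lra.
Qed.

Lemma is_derive_addl (c s : R) : is_derive s 1 (fun s => c + s) 1.
Proof.
have := is_deriveD (is_derive_cst c s 1) (is_derive_id s 1).
by rewrite add0r.
Qed.

Lemma is_derive_ln_shift (c s : R) : 0 < c + s ->
  is_derive s 1 (fun s => ln (c + s)) (c + s)^-1.
Proof.
move=> cs; have h := is_derive_addl c s.
have := @is_derive1_comp _ (@ln R) (fun s => c + s) s _ _ (is_derive1_ln cs) h.
by rewrite mulr1.
Qed.

Lemma is_derive_wmul (w s df : R) f : (w = 0 \/ is_derive s 1 f df) ->
  is_derive s 1 (fun s => w * f s) (w * df).
Proof.
case=> [->|df_]; last exact: is_deriveZ.
rewrite mul0r (_ : (fun _ => _) = cst 0); first exact: is_derive_cst.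
by apply/funext => u; rewrite mul0r.
Qed.

Lemma is_derive_bigsum n (h : 'I_n -> R -> R) (dh : 'I_n -> R) s :
    (forall i, is_derive s 1 (h i) (dh i)) ->
  is_derive s 1 (fun s => \sum_i h i s) (\sum_i dh i).
Proof.
move=> dh_; rewrite (_ : (fun _ => _) = \sum_i h i); first exact: is_derive_sum.
by apply/funext => u; rewrite fct_sumE.
Qed.

(* Unlike [log_divdiff], not guarded against nonpositive arguments, so that it
   can be differentiated in s. *)
Definition lndd (a b s : R) :=
  if a == b then (a + s)^-1 else (ln (a + s) - ln (b + s)) / (a - b).

Lemma is_derive_lndd (a b s : R) : 0 < a + s -> 0 < b + s ->
  is_derive s 1 (lndd a b) (- ((a + s)^-1 * (b + s)^-1)).
Proof.
move=> sa sb; rewrite /lndd; case: eqVneq => [<-|ab].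
  have a0 : a + s != 0 by rewrite gt_eqF.
  apply: (is_derive_eq (is_deriveV (f := fun u => a + u) a0 (is_derive_addl a s))).
  by rewrite -[in RHS]expr2 exprVn /GRing.scale /= mulr1.
have h := is_deriveZ (a - b)^-1
  (is_deriveB (is_derive_ln_shift sa) (is_derive_ln_shift sb)).
rewrite (_ : (fun _ => _) = (a - b)^-1 \*: ((fun s => ln (a + s)) - (fun s => ln (b + s)))).
  apply: (is_derive_eq h); rewrite /GRing.scale /=.
  have sa0 := gt_eqF sa; have sb0 := gt_eqF sb.
  have ab0 : a - b != 0 by rewrite subr_eq0.
  by field; rewrite ab0 sa0 sb0.
by apply/funext => u; rewrite mulrC.
Qed.

Lemma ln_diff (c s : R) : 0 <= c -> 0 < s -> 0 <= ln (c + s) - ln s <= c / s.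
Proof.
move=> c0 s0; have cs : 0 < c + s by rewrite ltr_wpDl.
rewrite -ln_div ?posrE // mulrDl divff ?gt_eqF //.
have cs0 : 0 <= c / s by rewrite divr_ge0 // ltW.
rewrite ln_ge0 ?lerDr // addrC le_ln1Dx //.
by rewrite (lt_le_trans _ cs0) // oppr_lt0.
Qed.

(** A divided difference of ln is at most the slope of ln at the smaller argument, which is at least
    s. *)
Lemma lndd_bound (a b s : R) : 0 <= a -> 0 <= b -> 0 < s -> `|lndd a b s| <= s^-1.
Proof.
move=> a0 b0 s0; rewrite /lndd; case: eqVneq => [_|ab].
  rewrite ger0_norm ?invr_ge0 ?addr_ge0 ?(ltW s0) //.
  by rewrite lef_pV2 ?posrE ?ltr_wpDl // lerDr.
wlog lt_ba : a b a0 b0 ab / b < a.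
  move=> W; have := ab; rewrite neq_lt => /orP[lt_ab|]; last exact: W.
  rewrite -mulrNN -invrN !opprB; apply: W => //; first by rewrite eq_sym.
have bs : 0 < b + s by rewrite ltr_wpDl.
have ab0 : 0 < a - b by rewrite subr_gt0.
have := @ln_diff (a - b) (b + s) (ltW ab0) bs.
rewrite addrA subrK => /andP[h1 h2].
rewrite ger0_norm ?divr_ge0 ?(ltW ab0) // ler_pdivrMr // mulrC.
apply: (le_trans h2); rewrite ler_wpM2l ?(ltW ab0) //.
by rewrite lef_pV2 ?posrE // lerDr.
Qed.

End RealCalculus.

(** * The shifted trace of rho log and its gradient inequality *)

Section LogTrace.
Variables (R : realType) (n : nat).
Local Notation C := R[i].
Local Notation Re := (@complex.Re R).
Local Notation eU := spectralmx.
Implicit Types (A B D M rho : 'M[C]_n) (s t u : R).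

Let eUu A : eU A \is unitarymx := spectral_unitarymx A.

(* Re Tr (rho log (B + s)) *)
Definition lnt rho B s : R :=
  \sum_i Re (inbase (eU B) rho i i) * ln (eigval B i + s).

(* Derivative at A + s of Re Tr (rho log), in the direction D. *)
Definition dlnt rho A D s : R :=
  \sum_i \sum_j Re (inbase (eU A) rho i j * inbase (eU A) D j i) *
    lndd (eigval A i) (eigval A j) s.

(** The dichotomy that makes every sum below differentiable down to s = 0: a summand either has zero
    weight or a positive argument. *)
Lemma suppd_or rho A i s : psdmx A -> suppd rho A -> 0 <= s ->
  (forall j, inbase (eU A) rho i j = 0) \/ 0 < eigval A i + s.
Proof.
move=> pA S s0; have := eigval_ge0 i pA; rewrite le_eqVlt => /predU1P[a0|a0].
  by left=> j; apply: S.
by right; rewrite ltr_pwDl.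
Qed.

Lemma is_derive_lnt rho B s : psdmx B -> suppd rho B \/ 0 < s -> 0 <= s ->
  is_derive s 1 (lnt rho B) (rtr (rho *m res B s)).
Proof.
move=> pB S s0; rewrite rtr_dg.
under eq_bigr do rewrite mulrC.
apply: is_derive_bigsum => i; apply: is_derive_wmul.
case: S => [S|s1]; last by right; apply: is_derive_ln_shift; exact: eig_shift_gt0.
by have [->|?] := suppd_or i pB S s0; [left|right; exact: is_derive_ln_shift].
Qed.

Lemma rtr_sandwich rho A D s : rtr (rho *m (res A s *m D *m res A s)) =
  \sum_i \sum_j Re (inbase (eU A) rho i j * inbase (eU A) D j i) *
     ((eigval A i + s)^-1 * (eigval A j + s)^-1).
Proof.
rewrite -(rtr_inbase (eUu A)) (inbaseM (eUu A) rho) (inbaseM (eUu A) (_ *m D)).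
rewrite (inbaseM (eUu A) _ D) (inbase_dg (eUu A)).
rewrite mul_mx_diag mul_diag_mx /rtr Re_sum; apply: eq_bigr => i _.
rewrite mxE Re_sum; apply: eq_bigr => j _.
by rewrite !(mxE, inE) [in RHS]mulrC -ReZ rmorphM; congr Re; ring.
Qed.

(** Termwise: the derivative of [lndd] is minus the product of two resolvent eigenvalues, which is
    the factor in [rtr_sandwich]. *)
Lemma is_derive_dlnt rho A D s : psdmx A -> psdmx rho -> suppd rho A -> 0 <= s ->
  is_derive s 1 (dlnt rho A D) (- rtr (rho *m (res A s *m D *m res A s))).
Proof.
move=> pA pr S s0; rewrite rtr_sandwich -sumrN.
apply: is_derive_bigsum => i; rewrite -sumrN; apply: is_derive_bigsum => j.
rewrite -mulrN; apply: is_derive_wmul.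
have [->|ai] := suppd_or i pA S s0; first by left; rewrite mul0r.
have [z|aj] := suppd_or j pA S s0; last by right; exact: is_derive_lndd.
by left; rewrite (psd_entryC i j (psd_inbase _ pr)) z rmorph0 mul0r.
Qed.

(** The growth Tr rho * ln s does not depend on [B], so it cancels in [lnt_rem] and leaves a
    remainder of order 1/s. *)
Lemma lnt_bound rho B : psdmx B -> psdmx rho ->
  exists K, forall s, 0 < s -> 0 <= lnt rho B s - rtr rho * ln s <= K / s.
Proof.
move=> pB pr; exists (\sum_i Re (inbase (eU B) rho i i) * eigval B i) => s s0.
rewrite -(rtr_inbase (eUu B) rho) /rtr Re_sum mulr_suml -sumrB mulr_suml.
have w0 i : 0 <= Re (inbase (eU B) rho i i).
  exact/Re_ge0/psd_diag_ge0/psd_inbase.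
have h i : 0 <= ln (eigval B i + s) - ln s <= eigval B i / s.
  by apply: ln_diff => //; exact: eigval_ge0.
apply/andP; split.
  apply: sumr_ge0 => i _; rewrite -mulrBr mulr_ge0 //.
  by have /andP[] := h i.
apply: ler_sum => i _; rewrite -mulrBr -mulrA ler_wpM2l //.
by have /andP[] := h i.
Qed.

Lemma dlnt_bound rho A D : psdmx A ->
  exists K, forall s, 0 < s -> `|dlnt rho A D s| <= K / s.
Proof.
move=> pA.
exists (\sum_i \sum_j `|Re (inbase (eU A) rho i j * inbase (eU A) D j i)|) => s s0.
rewrite mulr_suml; apply: (le_trans (ler_norm_sum _ _ _)).
apply: ler_sum => i _; rewrite mulr_suml; apply: (le_trans (ler_norm_sum _ _ _)).
apply: ler_sum => j _; rewrite normrM ler_wpM2l //.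
by apply: lndd_bound => //; exact: eigval_ge0.
Qed.

Lemma dlntZ rho A D t s : dlnt rho A (t%:C *: D) s = t * dlnt rho A D s.
Proof.
rewrite /dlnt mulr_sumr; apply: eq_bigr => i _; rewrite mulr_sumr.
apply: eq_bigr => j _; rewrite mulrA -ReZ; congr (Re _ * _).
rewrite /inbase -scalemxAr -scalemxAl [in LHS](mxE _ _ j i).
by rewrite mulrCA.
Qed.

Lemma psd_ctrB A B : psdmx A -> psdmx B -> (A - B)^t* = A - B.
Proof. by move=> pA pB; rewrite ctrB !psd_herm. Qed.

Lemma psd_sandwich A D M u : D^t* = D -> psdmx M ->
  psdmx (res A u *m D *m M *m D *m res A u).
Proof.
move=> hD /(psd_conj (res A u *m D)).
by rewrite ctrM res_herm hD !mulmxA.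
Qed.

(** The first-order Taylor remainder F(s). *)
Definition lnt_rem rho A B s := lnt rho B s - lnt rho A s - dlnt rho A (B - A) s.

Lemma is_derive_rem rho A B s : psdmx A -> psdmx B -> psdmx rho ->
    suppd rho A -> suppd rho B \/ 0 < s -> 0 <= s ->
  is_derive s 1 (lnt_rem rho A B)
    (rtr (rho *m (res B s - res A s + res A s *m (B - A) *m res A s))).
Proof.
move=> pA pB pr SA SB s0.
have d1 := is_derive_lnt pB SB s0.
have d2 := is_derive_lnt pA (or_introl SA) s0.
have d3 := is_derive_dlnt (B - A) pA pr SA s0.
have -> : lnt_rem rho A B = lnt rho B - lnt rho A - dlnt rho A (B - A) by [].
apply: (is_derive_eq (is_deriveB (is_deriveB d1 d2) d3)).
by rewrite opprK [in RHS]mulmxDr rtrD [in RHS]mulmxBr rtrB.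
Qed.

Lemma rem_bound rho A B : psdmx A -> psdmx B -> psdmx rho ->
  exists K, forall s, 0 < s -> `|lnt_rem rho A B s| <= K / s.
Proof.
move=> pA pB pr.
have [K1 h1] := lnt_bound pB pr; have [K2 h2] := lnt_bound pA pr.
have [K3 h3] := dlnt_bound rho (B - A) pA.
exists (K1 + K2 + K3) => s s0; rewrite /lnt_rem.
have := h1 s s0; have := h2 s s0; have := h3 s s0.
rewrite !mulrDl !ler_norml => /andP[a1 a2] /andP[b1 b2] /andP[c1 c2].
by apply/andP; split; lra.
Qed.

Lemma log_trace_gradient rho A B : psdmx A -> psdmx B -> psdmx rho ->
    suppd rho A -> suppd rho B ->
  lnt rho B 0 <= lnt rho A 0 + dlnt rho A (B - A) 0.
Proof.
move=> pA pB pr SA SB; have [K hK] := rem_bound pA pB pr.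
suff : lnt_rem rho A B 0 <= 0 by rewrite /lnt_rem; lra.
(* F is nondecreasing, hence F(0) <= F(s) <= K / s for every s > 0. *)
apply: (@le0_bounded_mul _ _ 0 K) => s s0.
rewrite -ler_pdivlMr //; apply: le_trans (le_trans (ler_norm _) (hK s s0)).
apply: (@is_derive_ge0_le _ (lnt_rem rho A B) (fun u => rtr (rho *m
    (res B u - res A u + res A u *m (B - A) *m res A u))) _ _ (ltW s0)).
  by move=> u u0; apply: (is_derive_rem pA pB pr SA) u0; left.
move=> u u0 /=; rewrite (res_expansion pA pB u0).
exact: (rtr_psd_ge0 pr (psd_sandwich A u (psd_ctrB pB pA) (res_psd pB u0))).
Qed.

End LogTrace.

(** * The one-sided derivative at a possibly singular minimiser *)

Section OneSidedDerivative.
Variables (R : realType) (n : nat).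
Local Notation C := R[i].
Local Notation Re := (@complex.Re R).
Local Notation eU := spectralmx.
Implicit Types (A B D M N T rho : 'M[C]_n) (s t u : R).

Let eUu A : eU A \is unitarymx := spectral_unitarymx A.

(** In the eigenbasis of [A] each of the three resolvents contributes a factor at most 1/s; the
    remaining weights do not depend on s. *)
Lemma resolvent_cube_bound rho A D : psdmx A -> exists2 K, 0 <= K & forall s, 0 < s ->
  rtr (rho *m (res A s *m D *m res A s *m D *m res A s)) <= K / s ^+ 3.
Proof.
move=> pA; set r' := inbase (eU A) rho; set D' := inbase (eU A) D.
exists (\sum_i \sum_j \sum_k `|Re (r' i j * D' j k * D' k i)|).
  by do 3!(apply: sumr_ge0 => ? _).
move=> s s0; have -> : rtr (rho *m (res A s *m D *m res A s *m D *m res A s)) =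
    \sum_i \sum_j \sum_k ((eigval A i + s)^-1 * (eigval A j + s)^-1 *
       (eigval A k + s)^-1) * Re (r' i j * D' j k * D' k i).
  rewrite -(rtr_inbase (eUu A)) (inbaseM (eUu A) rho) (inbaseM (eUu A) (_ *m D)).
  rewrite (inbaseM (eUu A) _ D) (inbaseM (eUu A) _ (res A s)) (inbaseM (eUu A) _ D).
  rewrite (inbase_dg (eUu A)) -/r' -/D' !mul_mx_diag mul_diag_mx.
  rewrite /rtr Re_sum; apply: eq_bigr => i _.
  rewrite mxE Re_sum; apply: eq_bigr => j _.
  rewrite mxE [in X in _ * (X * _)]mxE mulr_suml mulr_sumr Re_sum.
  apply: eq_bigr => k _; rewrite 2!mxE [(\row__ _) 0 i]mxE [(\row__ _) 0 j]mxE [(\row__ _) 0 k]mxE.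
  by rewrite -ReZ !rmorphM; congr Re; ring.
rewrite mulr_suml; apply: ler_sum => i _; rewrite mulr_suml; apply: ler_sum => j _.
rewrite mulr_suml; apply: ler_sum => k _; rewrite mulrC.
have e0 l : 0 <= (eigval A l + s)^-1 by rewrite invr_ge0 ltW // eig_shift_gt0.
have e1 l : (eigval A l + s)^-1 <= s^-1.
  by rewrite lef_pV2 ?posrE ?eig_shift_gt0 // lerDr eigval_ge0.
apply: (le_trans (ler_wpM2r _ (ler_norm _))); first by rewrite !mulr_ge0.
rewrite ler_wpM2l // -exprVn 2!exprSr expr1.
by rewrite ler_pM ?mulr_ge0 // ler_pM.
Qed.

Lemma sandwichB N D M M' c :
  N *m D *m (c *: M - M') *m D *m N =
  c *: (N *m D *m M *m D *m N) - N *m D *m M' *m D *m N.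
Proof. by rewrite mulmxBr !mulmxBl -scalemxAr -!scalemxAl. Qed.

(** Meant for a = Tr rho (A + u)^-1, b = Tr rho (B + u)^-1 and c = 1 / (1 - t): then b - a <= (c -
    1) a <= 2 t a. *)
Lemma excess_le (a b c t K : R) : 0 <= a -> 0 <= t -> c - 1 <= 2 * t ->
  a * 2 <= K -> 0 <= c * a - b -> b - a <= t * K.
Proof.
move=> a0 t0 c2 aK h.
by have := ler_wpM2r a0 c2; have := ler_wpM2l t0 aK; move: h; lra.
Qed.

Lemma inv_subr1_le t : 0 < t -> t <= 2^-1 -> (1 - t)^-1 - 1 <= 2 * t.
Proof.
move=> t0 t2; have t1 : 0 < 1 - t by move: t2; lra.
have -> : (1 - t)^-1 - 1 = t / (1 - t) by field; rewrite gt_eqF.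
by rewrite ler_pdivrMr //; have := ler_wpM2l (ltW t0) t2; lra.
Qed.

Lemma inv_subr_le2 t : 0 < t -> t <= 2^-1 -> (1 - t)^-1 <= 2.
Proof. by move=> t0 t2; have := inv_subr1_le t0 t2; move: t2; lra. Qed.

Lemma mix_expand A T t : A + t%:C *: (T - A) = (1 - t)%:C *: A + t%:C *: T.
Proof. by rewrite rmorphB scalerBl scale1r scalerBr addrCA addrC. Qed.

Lemma psd_mix A T t : psdmx A -> psdmx T -> 0 <= t <= 1 ->
  psdmx (A + t%:C *: (T - A)).
Proof.
move=> pA pT /andP[t0 t1]; rewrite mix_expand.
by apply: psdD; apply: psdZ; rewrite ?subr_ge0.
Qed.

Lemma res_mix A T t s : psdmx A -> psdmx T -> 0 < t < 1 -> 0 < s ->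
  psdmx (((1 - t)^-1)%:C *: res A s - res (A + t%:C *: (T - A)) s).
Proof.
move=> pA pT /andP[t0 t1] s0.
have h0 : 0 < 1 - t by rewrite subr_gt0.
have h1 : 1 - t <= 1 by rewrite gerBl ltW.
have h2 : 0 <= t <= 1 by rewrite !ltW.
apply: (res_antitone h0 h1 s0 pA (psd_mix pA pT h2)).
by rewrite mix_expand addrAC subrr add0r; exact: (psdZ (ltW t0) pT).
Qed.

(* Uniform down to s = 0 even for singular A, because
   A + t (T - A) + s >= (1 - t) (A + s). *)
Lemma lnt_mix_shift rho A T : psdmx rho -> psdmx A -> psdmx T -> suppd rho A ->
  exists2 K, 0 <= K & forall t s B, B = A + t%:C *: (T - A) ->
    0 < t -> t <= 2^-1 -> 0 <= s ->
    lnt rho B s - lnt rho A s <= lnt rho B 0 - lnt rho A 0 + t * s * K.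
Proof.
move=> pr pA pT S; set w := fun i => Re (inbase (eU A) rho i i).
have w0 i : 0 <= w i by exact/Re_ge0/psd_diag_ge0/psd_inbase.
(* Zero eigenvalues contribute nothing, since the weight [w i] vanishes there. The factor 2 comes
   from 1 / (1 - t) - 1 <= 2 t for t <= 1/2. *)
exists (2 * \sum_i w i / eigval A i).
  by rewrite mulr_ge0 // sumr_ge0 // => i _; rewrite divr_ge0 // eigval_ge0.
set K := 2 * _ => t s B BE t0 t2 s0.
have t1 : t < 1 by move: t2; lra.
have t01 : 0 < t < 1 by rewrite t0.
have pB : psdmx B by rewrite BE; apply: (psd_mix pA pT); rewrite !ltW.
have SB : suppd rho B by move: pB; rewrite BE; exact: (suppd_mix pr pA pT (ltW t0) t1 S).
pose f u := t * K * u - (lnt rho B u - lnt rho A u).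
suff : f 0 <= f s by rewrite /f mulr0; lra.
pose f' u := t * K - (rtr (rho *m res B u) - rtr (rho *m res A u)).
apply: (is_derive_ge0_le s0 (f' := f')) => u u0.
  have d1 := is_derive_lnt pB (or_introl SB) u0.
  have d2 := is_derive_lnt pA (or_introl S) u0.
  have d3 := is_deriveZ (t * K) (is_derive_id u 1).
  apply: (is_derive_eq (is_deriveB d3 (is_deriveB d1 d2))).
  by rewrite /f' /GRing.scale /= mulr1.
have := rtr_psd_ge0 pr (res_mix pA pT t01 u0).
rewrite mulmxBr rtrB -scalemxAr rtrZ -BE => h.
have rA : 0 <= rtr (rho *m res A u) by exact: (rtr_psd_ge0 pr (res_psd pA u0)).
have rK : rtr (rho *m res A u) * 2 <= K.
  rewrite rtr_dg /K mulrC ler_wpM2l // ler_sum // => i _.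
  have [z|a0] := suppd_or i pA S (lexx 0); first by rewrite /w z mulr0 mul0r.
  rewrite addr0 in a0; rewrite mulrC; apply: (ler_wpM2l (w0 i)).
  have au := eig_shift_gt0 i pA u0.
  by rewrite lef_pV2 ?posrE // lerDl ltW.
have c2 := inv_subr1_le t0 t2.
by rewrite /f' subr_ge0; exact: (excess_le rA (ltW t0) c2 rK h).
Qed.

(** The bound (B + v)^-1 <= 2 (A + v)^-1 gives F'(v) = O(t^2 / v^3); integrating from s to infinity,
    where F vanishes, yields the estimate. *)
Lemma rem_mix rho A T : psdmx rho -> psdmx A -> psdmx T -> suppd rho A ->
  exists2 K, 0 <= K & forall t s B, B = A + t%:C *: (T - A) ->
    0 < t -> t <= 2^-1 -> 0 < s ->
    - lnt_rem rho A B s <= t ^+ 2 * K / s ^+ 2.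
Proof.
move=> pr pA pT S.
have [K0 K00 hK0] := resolvent_cube_bound rho (T - A) pA.
exists (2 * K0); first by rewrite mulr_ge0.
move=> t s B BE t0 t2 s0.
have t1 : t < 1 by move: t2; lra.
have t01 : 0 < t < 1 by rewrite t0.
have pB : psdmx B by rewrite BE; apply: (psd_mix pA pT); rewrite !ltW.
have [K hK] := rem_bound pA pB pr.
set L := t ^+ 2 * (2 * K0).
have L0 : 0 <= L by rewrite mulr_ge0 ?exprn_ge0 ?(ltW t0) // mulr_ge0.
have DE : B - A = t%:C *: (T - A) by rewrite BE addrC addKr.
(* The integration is done by comparison: for v > s, F'(v) <= L / v^3 <= L / (s v^2), so [f] is
   nondecreasing on [s, oo). As f(u) <= K / u, it follows that f(s) <= 0. *)
pose f u := - lnt_rem rho A B u - L / s * u^-1.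
pose g u := rtr (rho *m (res B u - res A u + res A u *m (B - A) *m res A u)).
pose f' u := - g u + L / s * u^-2.
suff fS u : s < u -> f s * u <= K.
  have : f s <= 0 by apply: le0_bounded_mul fS.
  rewrite /f subr_le0 => /le_trans; apply.
  by rewrite -mulrA -invfM -expr2.
move=> su; have u0 := lt_trans s0 su.
have fsu : f s <= f u.
  apply: (@is_derive_ge0_le _ f f'); first exact: ltW.
    move=> v sv; have v0 : 0 < v := lt_le_trans s0 sv.
    have d1 := is_derive_rem pA pB pr S (or_intror v0) (ltW v0).
    have d2 := is_deriveZ (L / s) (is_deriveV (f := id) (lt0r_neq0 v0) (is_derive_id v 1)).
    apply: (is_derive_eq (is_deriveB (is_deriveN d1) d2)).
    by rewrite /f' /g /GRing.scale /= mulr1 mulrN opprK.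
  move=> v sv; have v0 : 0 < v := lt_trans s0 sv.
  rewrite /f' addrC subr_ge0 /g (res_expansion pA pB v0).
  have hD := psd_ctrB pT pA.
  rewrite DE; move: (T - A) hD (hK0 v v0) => D hD {}hK0.
  have := rtr_psd_ge0 pr (psd_sandwich A v hD (res_mix pA pT t01 v0)).
  have := rtr_psd_ge0 pr (psd_sandwich A v hD (res_psd pA v0)).
  rewrite sandwichB mulmxBr rtrB -scalemxAr rtrZ -BE subr_ge0 => E0 h.
  have -> : rtr (rho *m (res A v *m (t%:C *: D) *m res B v *m (t%:C *: D) *m res A v)) =
      t ^+ 2 * rtr (rho *m (res A v *m D *m res B v *m D *m res A v)).
    by rewrite -!(scalemxAr, scalemxAl) !rtrZ mulrA.
  have -> : L / s / v ^+ 2 = t ^+ 2 * (2 * (K0 * (s^-1 / v ^+ 2))) by rewrite /L !mulrA.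
  rewrite ler_wpM2l ?exprn_ge0 ?(ltW t0) //; apply: (le_trans h).
  have c0 : 0 <= (1 - t)^-1 by rewrite invr_ge0 subr_ge0 ltW.
  apply: (ler_pM c0 E0 (inv_subr_le2 t0 t2)); apply: (le_trans hK0).
  rewrite ler_wpM2l // exprSr invfM mulrC.
  by rewrite ler_wpM2r ?invr_ge0 ?exprn_ge0 ?(ltW v0) // lef_pV2 ?posrE // ltW.
rewrite -ler_pdivlMr //; apply: (le_trans fsu).
have := hK u u0; rewrite ler_norml => /andP[h _].
have : 0 <= L / s * u^-1 by rewrite !mulr_ge0 ?invr_ge0 // ltW.
by rewrite /f; move: h; lra.
Qed.

Lemma dlnt_le0 rho A T : psdmx rho -> psdmx A -> psdmx T -> suppd rho A ->
    (forall t, 0 < t < 1 -> lnt rho (A + t%:C *: (T - A)) 0 <= lnt rho A 0) ->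
  dlnt rho A (T - A) 0 <= 0.
Proof.
move=> pr pA pT S H.
have [K1 K10 h1] := lnt_mix_shift pr pA pT S.
have [K2 K20 h2] := rem_mix pr pA pT S.
have bound s : 0 < s -> s <= 2^-1 -> dlnt rho A (T - A) s <= (K1 + K2) * s.
  (* With this t both errors, t s K1 from the shift and t^2 K2 / s^2 from the remainder, are t times
     O(s), so dividing by t leaves a bound that vanishes with s. *)
  move=> s0 s2; pose t := s ^+ 3.
  have t0 : 0 < t by rewrite exprn_gt0.
  have t2 : t <= 2^-1 by rewrite /t !exprS expr0; move: s0 s2; nra.
  have t01 : 0 < t < 1 by rewrite t0 /=; move: t2; lra.
  have := h1 t s _ erefl t0 t2 (ltW s0); have := h2 t s _ erefl t0 t2 s0; have := H t t01.
  rewrite /lnt_rem; set B := A + _.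
  have -> : B - A = t%:C *: (T - A) by rewrite /B addrC addKr.
  rewrite dlntZ => a b c.
  have b' : t ^+ 2 * K2 / s ^+ 2 = t * (s * K2).
    by rewrite /t; field; rewrite gt_eqF.
  rewrite b' in b; rewrite -(ler_pM2l t0); move: a b c.
  by set x := t * dlnt _ _ _ _; lra.
rewrite leNgt; apply/negP => d0.
have d := is_derive_dlnt (T - A) pA pr S (lexx 0).
have c : {for 0, continuous (dlnt rho A (T - A))}.
  by apply/differentiable_continuous/derivable1_diffP; case: d.
set d0' := dlnt rho A (T - A) 0 in d0 *.
have e0 : 0 < d0' / 2 by rewrite divr_gt0.
(* Below this threshold [bound] keeps the value under d0'/2, while continuity at 0 keeps it above.
   The added 1 makes the denominator positive. *)
have eK : 0 < d0' / 2 / (K1 + K2 + 1) by rewrite divr_gt0 // ltr_wpDl ?addr_ge0.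
have /cvgrPdist_lt/(_ _ e0) c' := cvg_at_right_filter c.
near ((0 : R)^'+)%classic => s.
have s0 : 0 < s by near: s; exact: nbhs_right_gt.
have s2 : s <= 2^-1 by near: s; apply: nbhs_right_le; rewrite invr_gt0.
have sK : s < d0' / 2 / (K1 + K2 + 1) by near: s; exact: nbhs_right_lt.
have : `|d0' - dlnt rho A (T - A) s| < d0' / 2 by near: s.
rewrite ltr_norml => /andP[_ h].
move: sK; rewrite ltr_pdivlMr ?ltr_wpDl ?addr_ge0 // => sK.
by have := bound s s0 s2; move: h sK s0; lra.
Unshelve. all: by end_near. Qed.

End OneSidedDerivative.

(** * The trace norm of hermitian matrices *)

Section TraceNorm.
Variables (R : realType) (n : nat).
Local Notation C := R[i].
Local Notation Re := (@complex.Re R).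
Local Notation eU := spectralmx.
Implicit Types (A B P N : 'M[C]_n) (x : R).

Definition rtrnorm A : R := \sum_i `|eigval A i|.

Lemma trnormE A : A^t* = A -> trnorm A = (rtrnorm A)%:C.
Proof.
move=> hA; have Uu := spectral_unitarymx A.
(* The eigenbasis of [A] also diagonalises its square, so [hermfun_dg] computes the square root
   there. *)
have AA : A^t* *m A = dg (eU A) (fun i => eigval A i * eigval A i).
  by rewrite hA {1 2}(spectral_dg hA) dgM.
rewrite /trnorm /absmx (hermfun_dg _ Uu AA) /dg mxtrace_mulC mulmxA UK // mul1mx.
rewrite mxtrace_diag /rtrnorm rmorph_sum; apply: eq_bigr => i _.
by rewrite mxE -expr2 sqrtr_sqr.
Qed.

Lemma rtrnorm_ge0 A : 0 <= rtrnorm A.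
Proof. by apply: sumr_ge0 => i _; exact: normr_ge0. Qed.

(** In the eigenbasis of P - N each eigenvalue is a difference of nonnegative diagonal entries of P
    and N. With [rtrnorm_split], the norm is the least Tr P + Tr N over such decompositions, whence
    the triangle inequality. *)
Lemma rtrnorm_le P N : psdmx P -> psdmx N -> rtrnorm (P - N) <= rtr P + rtr N.
Proof.
move=> pP pN; have hA := psd_ctrB pP pN.
set A := P - N in hA *; have Uu := spectral_unitarymx A.
rewrite -(rtr_inbase Uu P) -(rtr_inbase Uu N) /rtr !Re_sum -big_split /=.
apply: ler_sum => i _.
have p0 := Re_ge0 (psd_diag_ge0 i (psd_inbase (eU A) pP)).
have n0 := Re_ge0 (psd_diag_ge0 i (psd_inbase (eU A) pN)).
have -> : eigval A i = Re (inbase (eU A) P i i) - Re (inbase (eU A) N i i).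
  have := congr1 Re (eigval_diag i hA); rewrite /= => <-.
  by rewrite {2}/A /inbase mulmxBr mulmxBl mxE [X in _ + X]mxE ReB.
by rewrite (le_trans (ler_normB _ _)) // !ger0_norm.
Qed.

(** The Jordan decomposition into positive and negative parts. *)
Lemma rtrnorm_split A : A^t* = A -> exists P N,
  [/\ psdmx P, psdmx N, A = P - N & rtr P + rtr N = rtrnorm A].
Proof.
move=> hA; have Uu := spectral_unitarymx A; set a := eigval A.
exists (dg (eU A) (fun i => (`|a i| + a i) / 2)), (dg (eU A) (fun i => (`|a i| - a i) / 2)).
split.
- apply: dg_psd => i; rewrite divr_ge0 // -[X in _ + X]opprK subr_ge0.
  by rewrite -normrN ler_norm.
- by apply: dg_psd => i; rewrite divr_ge0 // subr_ge0 ler_norm.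
- rewrite -scaleN1r; have -> : (-1 : C) = (-1)%:C by rewrite rmorphN1.
  rewrite dgZ dgD {1}(spectral_dg hA) -/a; congr dg; apply/funext => i; lra.
rewrite !(rtr_dgE Uu) -big_split; apply: eq_bigr => i _ /=; rewrite -/a; lra.
Qed.

Lemma rtrnormD A B : A^t* = A -> B^t* = B ->
  rtrnorm (A + B) <= rtrnorm A + rtrnorm B.
Proof.
move=> /rtrnorm_split[P [N [pP pN -> <-]]] /rtrnorm_split[P' [N' [pP' pN' -> <-]]].
rewrite addrACA -opprD (le_trans (rtrnorm_le (psdD pP pP') (psdD pN pN'))) //.
by rewrite !rtrD addrACA.
Qed.

Lemma rtrnormZ x A : 0 <= x -> A^t* = A -> rtrnorm (x%:C *: A) <= x * rtrnorm A.
Proof.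
move=> x0 /rtrnorm_split[P [N [pP pN -> <-]]].
rewrite scalerBr (le_trans (rtrnorm_le (psdZ x0 pP) (psdZ x0 pN))) //.
by rewrite !rtrZ mulrDr.
Qed.

Lemma psd_scalar x : 0 <= x -> psdmx (x%:C%:M : 'M[C]_n).
Proof.
have Uu := spectral_unitarymx (0 : 'M[C]_n).
by move=> x0; rewrite -(dg_cst Uu); exact: dg_psd.
Qed.

Lemma rtrnorm_scalar x : 0 <= x -> rtrnorm x%:C%:M <= x * n%:R.
Proof.
move=> x0; have := rtrnorm_le (psd_scalar x0) (psd_scalar (lexx 0)).
have -> : 0%:C%:M = 0 :> 'M[C]_n by apply/matrixP => i j; rewrite !mxE mul0rn.
rewrite subr0 => /le_trans; apply.
have Uu := spectral_unitarymx (0 : 'M[C]_n).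
rewrite {2}/rtr linear0 addr0 -(dg_cst Uu) (rtr_dgE Uu) sumr_const card_ord.
by rewrite mulr_natr.
Qed.

End TraceNorm.

(** * Partial transposition and convexity of the set of the Rains bound *)

Section RainsSet.
Variables (R : realType) (n1 n2 : nat) (first : bool).
Local Notation C := R[i].
Local Notation n := (n1 * n2)%N.
Implicit Types (A B T : 'M[C]_n) (x t : R).
Local Notation pt := (@ptrmx R n1 n2 first).

Lemma ptrmxD A B : pt (A + B) = pt A + pt B.
Proof.
apply/matrixP => k l; rewrite !mxE; case: mxtens_unindex => a b.
by case: mxtens_unindex => c d; case: first; rewrite mxE.
Qed.

Lemma ptrmxZ x A : pt (x%:C *: A) = x%:C *: pt A.
Proof.
apply/matrixP => k l; rewrite !mxE; case: mxtens_unindex => a b.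
by case: mxtens_unindex => c d; case: first; rewrite mxE.
Qed.

Lemma ptrmx_herm A : A^t* = A -> (pt A)^t* = pt A.
Proof.
move=> hA; apply/matrixP => k l; rewrite !mxE; case: mxtens_unindex => a b.
by case: mxtens_unindex => c d; case: first; rewrite -{2}hA !mxE.
Qed.

Lemma ptrmx_scalar x : pt x%:C%:M = x%:C%:M.
Proof.
apply/matrixP => k l; rewrite -(mxtens_unindexK k) -(mxtens_unindexK l).
move: (mxtens_unindex k) (mxtens_unindex l) => [a b] [c d].
rewrite mxE !mxtens_indexK.
have idx (i j : 'I_n1 * 'I_n2) : (mxtens_index i == mxtens_index j) = (i == j).
  exact/inj_eq/(can_inj (@mxtens_indexK _ _)).
case: first; rewrite !mxE !idx !xpair_eqE //.
  by rewrite [a == c]eq_sym.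
by rewrite [b == d]eq_sym.
Qed.

Lemma rains_setP A : rains_set first A <-> psdmx A /\ rtrnorm (pt A) <= 1.
Proof.
split=> -[pA nA]; have h := ptrmx_herm (psd_herm pA); split=> //.
  by move: nA; rewrite (trnormE h) lecR.
by rewrite (trnormE h) lecR.
Qed.

Lemma rains_set_mix A T t : rains_set first A -> rains_set first T ->
  0 <= t <= 1 -> rains_set first (A + t%:C *: (T - A)).
Proof.
move=> /rains_setP[pA nA] /rains_setP[pT nT] /[dup] t01 /andP[t0 t1].
apply/rains_setP; split; first exact: psd_mix.
have t1' : 0 <= 1 - t by rewrite subr_ge0.
have hA := ptrmx_herm (psd_herm pA); have hT := ptrmx_herm (psd_herm pT).
rewrite mix_expand ptrmxD !ptrmxZ.
apply: (le_trans (rtrnormD _ _)); rewrite ?ctrZ ?hA ?hT //.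
apply: (le_trans (lerD (rtrnormZ t1' hA) (rtrnormZ t0 hT))).
by rewrite (le_trans (lerD (ler_wpM2l t1' nA) (ler_wpM2l t0 nT))) // !mulr1 subrK.
Qed.

Lemma rains_setZ A x : rains_set first A -> 0 <= x -> x * rtrnorm (pt A) <= 1 ->
  rains_set first (x%:C *: A).
Proof.
move=> /rains_setP[pA nA] x0 xA; apply/rains_setP; split; first exact: psdZ.
by rewrite ptrmxZ (le_trans (rtrnormZ x0 (ptrmx_herm (psd_herm pA)))).
Qed.

(** An invertible member, which makes the infimum finite. The denominator n + 1 is nonzero for every
    n. *)
Lemma rains_set_scalar : rains_set first ((n.+1%:R^-1)%:C%:M : 'M[C]_n).
Proof.
have e0 : 0 <= n.+1%:R^-1 :> R by rewrite invr_ge0.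
apply/rains_setP; split; first exact: psd_scalar.
rewrite ptrmx_scalar (le_trans (rtrnorm_scalar _ e0)) //.
by rewrite mulrC ler_pdivrMr // mul1r ler_nat.
Qed.

End RainsSet.

(** Room to scale up a matrix whose partial transpose has norm x < 1. The witness is the harmonic
    mean of 1 and 1/x, written so that x = 0 is allowed. *)
Lemma scale_gt1 (R : realFieldType) (x : R) : 0 <= x -> x < 1 ->
  exists2 c, 1 < c & c * x <= 1.
Proof.
move=> x0 x1; have y0 : 0 < 1 + x by rewrite ltr_wpDr.
exists (2 / (1 + x)); first by rewrite ltr_pdivlMr //; lra.
by rewrite mulrAC ler_pdivrMr //; lra.
Qed.

(** * Relative entropy and the map L in terms of the logarithmic traces *)

Section RelativeEntropy.
Variables (R : realType) (n : nat).
Local Notation C := R[i].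
Local Notation Re := (@complex.Re R).
Local Notation eU := spectralmx.
Implicit Types (A B D rho : 'M[C]_n).

Lemma rtr_logmx rho A : rtr (rho *m logmx A) = lnt rho A 0.
Proof.
rewrite /logmx /hermfun -/(dg _ (fun i => ln (eigval A i))) rtr_dg.
by apply: eq_bigr => i _; rewrite addr0 mulrC.
Qed.

Lemma relent_suppd rho A : psdmx rho -> psdmx A -> suppd rho A ->
  relent rho A = (lnt rho rho 0 - lnt rho A 0)%:E.
Proof.
move=> pr pA S; rewrite /relent asboolT; last exact/(suppdP pr pA).
by rewrite -/(rtr _) mulmxBr rtrB !rtr_logmx.
Qed.

Lemma relentNsuppd rho A : psdmx rho -> psdmx A -> ~ suppd rho A ->
  relent rho A = +oo%E.
Proof.
by move=> pr pA S; rewrite /relent asboolF // => /(suppdP pr pA).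
Qed.

Lemma trace_Lmx rho A D : \tr (Lmx A rho *m D) =
  \sum_i \sum_j (log_divdiff (eigval A i) (eigval A j))%:C *
     (inbase (eU A) rho i j * inbase (eU A) D j i).
Proof.
rewrite /Lmx -/(inbase (eU A) rho); set M := \matrix_(i, j) _.
have -> : (eU A)^t* *m M *m eU A *m D = (eU A)^t* *m (M *m (eU A *m D)).
  by rewrite !mulmxA.
rewrite mxtrace_mulC -(mulmxA M) -/(inbase (eU A) D).
rewrite /mxtrace; apply: eq_bigr => i _; rewrite mxE; apply: eq_bigr => j _.
by rewrite mxE mulrA.
Qed.

Lemma log_divdiffC (a b : R) : log_divdiff a b = log_divdiff b a.
Proof.
rewrite /log_divdiff andbC [a == b]eq_sym; case: ifP => // _.
by case: eqVneq => [->//|_]; rewrite -mulrNN -invrN !opprB.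
Qed.

Lemma Lmx_herm rho A : rho^t* = rho -> (Lmx A rho)^t* = Lmx A rho.
Proof.
move=> hr; rewrite /Lmx -/(inbase (eU A) rho); set M := \matrix_(i, j) _.
have hr' : (inbase (eU A) rho)^t* = inbase (eU A) rho.
  by rewrite /inbase !ctrM trmxCK hr mulmxA.
have hM : M^t* = M.
  have rE i j : inbase (eU A) rho i j = Num.conj (inbase (eU A) rho j i).
    by rewrite -{1}hr' mxE mxE.
  have ME i j : M i j = (log_divdiff (eigval A i) (eigval A j))%:C * inbase (eU A) rho i j.
    by rewrite mxE.
  apply/matrixP => i j; rewrite mxE mxE ME ME (rE i j) rmorphM log_divdiffC.
  by congr (_ * _); exact: conjCR.
by rewrite !ctrM trmxCK hM mulmxA.
Qed.

(** Turns comparisons of traces in the partial order of [R[i]] into comparisons in [R]. *)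
Lemma trace_Lmx_real rho A D : rho^t* = rho -> D^t* = D ->
  \tr (Lmx A rho *m D) = (rtr (Lmx A rho *m D))%:C.
Proof.
move=> hr hD; rewrite /rtr RRe_real //; apply/CrealP.
by rewrite -trace_ctr ctrM hD Lmx_herm // mxtrace_mulC.
Qed.

(** The guarded [log_divdiff] and the unguarded [lndd] differ only at zero eigenvalues, where the
    entries of rho vanish. *)
Lemma rtr_Lmx rho A D : psdmx rho -> psdmx A -> suppd rho A ->
  rtr (Lmx A rho *m D) = dlnt rho A D 0.
Proof.
move=> pr pA S; rewrite /rtr trace_Lmx Re_sum; apply: eq_bigr => i _.
rewrite Re_sum; apply: eq_bigr => j _; rewrite ReZ mulrC.
have [->|ai] := suppd_or i pA S (lexx 0); first by rewrite !mul0r.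
have [z|aj] := suppd_or j pA S (lexx 0).
  by rewrite (psd_entryC i j (psd_inbase _ pr)) z rmorph0 !mul0r.
by move: ai aj; rewrite /log_divdiff /lndd !addr0 => -> ->.
Qed.

(** [A] is diagonal in its eigenbasis, so only terms a * (1/a) = 1 with a > 0 survive. *)
Lemma trace_Lmx_self rho A : psdmx A ->
  \tr (Lmx A rho *m A) = \sum_(i | 0 < eigval A i) inbase (eU A) rho i i.
Proof.
move=> pA; rewrite trace_Lmx [RHS]big_mkcond; apply: eq_bigr => i _.
rewrite (bigD1 i) //= big1 ?addr0 => [|j ji].
  rewrite (eigval_diag i (psd_herm pA)) /log_divdiff eqxx andbb.
  case: ifP => a0; last by rewrite mul0r.
  by rewrite mulrCA -rmorphM mulVf ?gt_eqF // mulr1.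
have -> : inbase (eU A) A j i = 0.
  rewrite {2}(spectral_dg (psd_herm pA)) inbase_dg ?spectral_unitarymx //.
  by rewrite !mxE (negPf ji).
by rewrite !mulr0.
Qed.

(** The two traces differ by the diagonal entries of rho on the kernel of [A]; these are
    nonnegative, and if they sum to 0, [psd_diag0] clears their rows. *)
Lemma trace_Lmx_suppd rho A : psdmx rho -> psdmx A ->
  \tr (Lmx A rho *m A) = \tr rho <-> suppd rho A.
Proof.
move=> pr pA; have Uu := spectral_unitarymx A; have pr' := psd_inbase (eU A) pr.
have -> : \tr rho = \sum_i inbase (eU A) rho i i.
  by rewrite -[RHS]/(\tr (inbase (eU A) rho)) /inbase mxtrace_mulC mulmxA KU // mul1mx.
rewrite trace_Lmx_self // [X in _ = X <-> _](bigID (fun i => 0 < eigval A i)) /=.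
split=> [/esym/(canRL (addKr _))|S].
  rewrite addNr => s0 i j ai.
  apply: (psd_diag0 _ pr').
  apply: (psumr_eq0P _ s0) => [k _|]; first exact: psd_diag_ge0.
  by rewrite ai ltxx.
rewrite [X in _ + X]big1 ?addr0 // => i; rewrite lt_def eigval_ge0 // andbT negbK.
by move/eqP => ai; exact: S.
Qed.

End RelativeEntropy.

(** * Optimality criterion: sufficiency first, then necessity *)

Theorem theorem9 (R : realType) (n1 n2 : nat) (first : bool)
    (rho taustar : 'M[R[i]]_(n1 * n2)) :
  state rho ->
  ~ ppt first rho ->
  rains_set first taustar ->
  rains first rho = relent rho taustar <->
  (trnorm (ptrmx first taustar) = 1 /\
   forall tau : 'M[R[i]]_(n1 * n2), rains_set first tau ->
     \tr (Lmx taustar rho *m tau) <= \tr (Lmx taustar rho *m taustar) /\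
     \tr (Lmx taustar rho *m taustar) = 1).
Proof.
move=> [pr tr1] _ At; set A := taustar in At *.
have [pA nA] := (rains_setP first A).1 At.
have hr := psd_herm pr.
have LreB tau : psdmx tau -> suppd rho A ->
    \tr (Lmx A rho *m tau) <= \tr (Lmx A rho *m A) <-> dlnt rho A (tau - A) 0 <= 0.
  move=> pT S; rewrite -(rtr_Lmx _ pr pA S) mulmxBr rtrB subr_le0.
  by rewrite (trace_Lmx_real _ hr (psd_herm pT)) (trace_Lmx_real _ hr (psd_herm pA)) lecR.
split=> [E|[_ H]]; last first.
  (* Testing with [A] itself extracts the trace value 1, which encodes the support condition. *)
  have [_ LA] := H A At.
  have S : suppd rho A by apply/(trace_Lmx_suppd pr pA); rewrite LA tr1.
  apply/le_anti/andP; split; first by apply: ereal_inf_lbound; exact: (imageP _ At).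
  apply: le_ereal_inf_tmp => _ [T Tt <-].
  have [pT nT] := (rains_setP first T).1 Tt.
  have [ST|ST] := pselect (suppd rho T); last first.
    by rewrite (relentNsuppd pr pT ST) leey.
  rewrite (relent_suppd pr pA S) (relent_suppd pr pT ST) lee_fin lerD2l lerN2.
  have d0 := (LreB T pT S).1 (H T Tt).1.
  by rewrite (le_trans (log_trace_gradient pA pT pr S ST)) // gerDl.
have Emin T : rains_set first T -> (relent rho A <= relent rho T)%E.
  by move=> Tt; rewrite -E; apply: ereal_inf_lbound; exact: (imageP _ Tt).
have S : suppd rho A.
  (* Otherwise the minimum would be infinite, although the scalar matrix gives a finite value. *)
  apply: contrapT => NS; have It := @rains_set_scalar R n1 n2 first.
  have [pI _] := (rains_setP first _).1 It.
  have := Emin _ It; rewrite (relentNsuppd pr pA NS) (relent_suppd pr pI) //.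
  apply/(suppdP pr pI) => v; rewrite mul_scalar_mx => /eqP.
  rewrite scaler_eq0 fmorph_eq0 invr_eq0 pnatr_eq0 /= => /eqP ->.
  by rewrite mulmx0.
have LA : \tr (Lmx A rho *m A) = 1 by rewrite -tr1; apply/(trace_Lmx_suppd pr pA).
have Lmax T : rains_set first T -> \tr (Lmx A rho *m T) <= \tr (Lmx A rho *m A).
  move=> Tt; have [pT nT] := (rains_setP first T).1 Tt.
  apply/(LreB T pT S); apply: (dlnt_le0 pr pA pT S) => t t01.
  have /andP[t0 t1] := t01.
  have t01' : 0 <= t <= 1 by rewrite !ltW.
  have Mt := rains_set_mix At Tt t01'.
  have pM := psd_mix pA pT t01'.
  have SM := suppd_mix pr pA pT (ltW t0) t1 S pM.
  have := Emin _ Mt; rewrite (relent_suppd pr pA S) (relent_suppd pr pM SM).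
  by rewrite lee_fin lerD2l lerN2.
split; last by move=> T Tt; split => //; exact: Lmax.
rewrite (trnormE (ptrmx_herm first (psd_herm pA))).
have [x1|x1|->//] := ltgtP (rtrnorm (ptrmx first A)) 1; last first.
  by move: nA; rewrite leNgt x1.
have x0 := rtrnorm_ge0 (ptrmx first A).
have [c c1 cx] := scale_gt1 x0 x1.
have c0 : 0 <= c by rewrite ltW // (lt_trans ltr01).
(* For c [A] with c > 1, maximality reads c <= 1, a contradiction. *)
have := Lmax _ (rains_setZ At c0 cx).
rewrite -scalemxAr mxtraceZ LA mulr1 -[1 in X in X -> _]/(1%:C) lecR.
by rewrite leNgt c1.
Qed.
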